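(* Let $A$ be decomposed into a core $K_0$ and ends $U_1,\dots,U_m$ with exhaustions $h_i$ and admissible weights $\varphi_i$ as in the context. Then $\bigl(\mathcal{A},\|\cdot\|^{\sharp}_{\mathbf{h},\boldsymbol{\varphi}}\bigr)$ is a Banach space.
   Context: $A$ is a non-compact, locally compact, $\sigma$-compact Hausdorff space; $C(A)$ is the space of real continuous functions on $A$ and $C(A)/\mathbb{R}$ its quotient by the constants. Decomposition at infinity: there is a compact $K_0\subset A$ (the core) and finitely many pairwise disjoint, open, connected, non-compact sets $U_1,\dots,U_m$ (the ends) with $A\setminus K_0=\bigsqcup_{i=1}^m U_i$. Each $U_i$ carries a continuous $h_i:U_i\to[0,\infty)$ such that (E1) $\{x\in U_i:h_i(x)\le R\}$ is relatively compact in $A$ for every $R<\infty$; (E2) $h_i$ extends continuously to $\overline{U_i}$ with $h_i\equiv0$ on $\partial U_i\subset K_0$; (E3) $h_i$ is unbounded on $U_i$; (E4) $\partial U_i=\overline{U_i}\setminus U_i\neq\varnothing$. Each end carries an admissible weight $\varphi_i$. Admissible means: $\varphi:[0,\infty)\to[1,\infty)$ is continuous, non-decreasing, $\varphi(0)=1$, and there is $K\ge1$ with $\varphi(r+s)\le K\varphi(r)\varphi(s)$ for all $r,s\ge0$. For $f\in C(A)$: $N_0(f):=\inf_{c\in\mathbb{R}}\sup_{x\in K_0}|f(x)-c|$, $N_i(f):=\inf_{c\in\mathbb{R}}\sup_{x\in U_i}\varphi_i(h_i(x))|f(x)-c|$ for $i=1,\dots,m$, and $\|[f]\|^{\sharp}_{\mathbf{h},\boldsymbol{\varphi}}:=\max\{N_0(f),N_1(f),\dots,N_m(f)\}\in[0,\infty]$.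 $\mathcal{A}:=\{[f]\in C(A)/\mathbb{R}:\|[f]\|^{\sharp}_{\mathbf{h},\boldsymbol{\varphi}}<\infty\}$. *)

(* Defs.v *)
From HB Require Import structures.
From mathcomp Require Import all_boot all_order all_algebra.
From mathcomp Require Import generic_quotient ring_quotient.
From mathcomp Require Import all_classical all_reals all_analysis.

Set Implicit Arguments.
Unset Strict Implicit.
Unset Printing Implicit Defensive.

Import Order.TTheory GRing.Theory Num.Theory.
Import numFieldNormedType.Exports.

Local Open Scope classical_set_scope.
Local Open Scope ring_scope.
Local Open Scope quotient_scope.

Section continuous_lmodule.
Context {A : topologicalType} {R : realType}.
Local Notation C := (continuousType A R).
Implicit Types (f g : C) (a : R).

Let cts0 : continuous (fun _ : A => 0 : R).
Proof. by move=> x; exact: cvg_cst. Qed.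

Let ctsN f : continuous (fun x => - f x).
Proof. by move=> x; apply: continuousN; exact: cts_fun. Qed.

Let ctsD f g : continuous (fun x => f x + g x).
Proof. by move=> x; apply: continuousD; exact: cts_fun. Qed.

Let ctsZ a f : continuous (fun x => a * f x).
Proof. by move=> x; apply: continuousM; [exact: cvg_cst|exact: cts_fun]. Qed.

Definition cts_zero : C := mkcts cts0.
Definition cts_opp f : C := mkcts (@ctsN f).
Definition cts_add f g : C := mkcts (@ctsD f g).
Definition cts_scale a f : C := mkcts (@ctsZ a f).

Let addA : associative cts_add.
Proof. by move=> f g k; apply/continuousEP => x; exact: addrA. Qed.

Let addC : commutative cts_add.
Proof. by move=> f g; apply/continuousEP => x; exact: addrC. Qed.

Let add0 : left_id cts_zero cts_add.
Proof. by move=> f; apply/continuousEP => x; exact: add0r. Qed.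

Let addN : left_inverse cts_zero cts_opp cts_add.
Proof. by move=> f; apply/continuousEP => x; exact: addNr. Qed.

HB.instance Definition _ := GRing.isZmodule.Build C addA addC add0 addN.

Let scaleA a b f : cts_scale a (cts_scale b f) = cts_scale (a * b) f.
Proof. by apply/continuousEP => x; exact: mulrA. Qed.

Let scale1 : left_id 1 cts_scale.
Proof. by move=> f; apply/continuousEP => x; exact: mul1r. Qed.

Let scaleDr : right_distributive cts_scale +%R.
Proof. by move=> a f g; apply/continuousEP => x; exact: mulrDr. Qed.

Let scaleDl f : {morph cts_scale^~ f : a b / a + b}.
Proof. by move=> a b; apply/continuousEP => x; exact: mulrDl. Qed.

HB.instance Definition _ :=
  GRing.Zmodule_isLmodule.Build R C scaleA scale1 scaleDr scaleDl.

Lemma cts_addE f g x : (f + g) x = f x + g x. Proof. by []. Qed.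
Lemma cts_oppE f x : (- f) x = - f x. Proof. by []. Qed.
Lemma cts_scaleE a f x : (a *: f) x = a * f x. Proof. by []. Qed.

End continuous_lmodule.

Section quotient_by_constants.
Context (A : topologicalType) (R : realType).
Local Notation C := (continuousType A R).

Definition constant_fun : {pred C} := fun f => `[< exists c, forall x, f x = c >].

Let constant_zmod : zmod_closed constant_fun.
Proof.
split=> [|f g /asboolP[c fc] /asboolP[d gd]]; apply/asboolP.
  by exists 0.
by exists (c - d) => x; rewrite cts_addE cts_oppE fc gd.
Qed.

HB.instance Definition _ := GRing.isZmodClosed.Build C constant_fun constant_zmod.

Definition C_mod_const := Quotient.quot constant_fun.

HB.instance Definition _ := ZmodQuotient.on C_mod_const.

Definition class_of (f : C) : C_mod_const := \pi_C_mod_const f.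

Lemma class_ofP f g : class_of f = class_of g <-> exists c, forall x, f x = g x + c.
Proof.
rewrite /class_of; split.
  move/eqP; rewrite -Quotient.idealrBE => /asboolP[c fgc]; exists c => x.
  by rewrite -(fgc x) cts_addE cts_oppE addrC subrK.
move=> [c fgc]; apply/eqP; rewrite -Quotient.idealrBE; apply/asboolP.
by exists c => x; rewrite cts_addE cts_oppE fgc addrC addKr.
Qed.

Lemma class_of_repr q : class_of (repr q) = q. Proof. exact: reprK. Qed.

Lemma class_ofD f g : class_of (f + g) = class_of f + class_of g.
Proof. by rewrite /class_of raddfD. Qed.

Definition C_mod_scale (a : R) (q : C_mod_const) : C_mod_const :=
  class_of (a *: repr q).

Lemma C_mod_scaleE a f : C_mod_scale a (class_of f) = class_of (a *: f).
Proof.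
apply/class_ofP; have /class_ofP[c fc] := class_of_repr (class_of f).
by exists (a * c) => x; rewrite !cts_scaleE fc mulrDr.
Qed.

Let scaleA a b q : C_mod_scale a (C_mod_scale b q) = C_mod_scale (a * b) q.
Proof. by rewrite -(class_of_repr q) !C_mod_scaleE scalerA. Qed.

Let scale1 : left_id 1 C_mod_scale.
Proof. by move=> q; rewrite -(class_of_repr q) C_mod_scaleE scale1r. Qed.

Let scaleDr : right_distributive C_mod_scale +%R.
Proof.
move=> a p q; rewrite -(class_of_repr p) -(class_of_repr q) -class_ofD.
by rewrite !C_mod_scaleE scalerDr class_ofD.
Qed.

Let scaleDl q : {morph C_mod_scale^~ q : a b / a + b}.
Proof.
by move=> a b; rewrite -(class_of_repr q) !C_mod_scaleE scalerDl class_ofD.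
Qed.

HB.instance Definition _ :=
  GRing.Zmodule_isLmodule.Build R C_mod_const scaleA scale1 scaleDr scaleDl.

Lemma class_ofZ a f : class_of (a *: f) = a *: class_of f.
Proof. by rewrite -C_mod_scaleE. Qed.

End quotient_by_constants.

Definition sigma_compact (A : topologicalType) :=
  exists K : nat -> set A, (forall n, compact (K n)) /\ \bigcup_n K n = setT.

(* Only the values of [h i] on [U i] are meaningful. *)
Record end_decomposition (A : topologicalType) (R : realType) (K0 : set A)
    (m : nat) (U : 'I_m -> set A) (h : 'I_m -> A -> R) : Prop := {
  core_compact : compact K0 ;
  end_open : forall i, open (U i) ;
  end_connected : forall i, connected (U i) ;
  end_noncompact : forall i, ~ compact (U i) ;
  end_disjoint : trivIset setT U ;
  end_cover : ~` K0 = \bigcup_i U i ;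
  exhaustion_ge0 : forall i x, U i x -> 0 <= h i x ;
  exhaustion_continuous : forall i, {within U i, continuous (h i)} ;
  exhaustion_precompact : forall i r, precompact [set x | U i x /\ h i x <= r] ;
  exhaustion_extends : forall i, exists g : A -> R,
    [/\ {within closure (U i), continuous g},
        (forall x, U i x -> g x = h i x) &
        (forall x, (closure (U i) `\` U i) x -> g x = 0)] ;
  end_boundary_core : forall i, closure (U i) `\` U i `<=` K0 ;
  exhaustion_unbounded : forall i r, exists2 x, U i x & r < h i x ;
  end_boundary_nonempty : forall i, closure (U i) `\` U i !=set0
}.

(* Only the values of [phi] on [0, +oo[ are meaningful. *)
Record admissible (R : realType) (phi : R -> R) : Prop := {
  weight_continuous : {within `[0, +oo[, continuous phi} ;
  weight_ge1 : forall r, 0 <= r -> 1 <= phi r ;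
  weight_nondecreasing : forall r s, 0 <= r -> r <= s -> phi r <= phi s ;
  weight0 : phi 0 = 1 ;
  weight_submul : exists2 K, 1 <= K &
    forall r s, 0 <= r -> 0 <= s -> phi (r + s) <= K * phi r * phi s
}.

Section sharp_norm.
Context (A : topologicalType) (R : realType).
Context (K0 : set A) (m : nat) (U : 'I_m -> set A) (h : 'I_m -> A -> R).
Context (phi : 'I_m -> R -> R).
Implicit Type f : A -> R.

Definition core_seminorm f : \bar R :=
  ereal_inf [set ereal_sup [set `|f x - c|%:E | x in K0] | c in [set: R]].

Definition end_seminorm (i : 'I_m) f : \bar R :=
  ereal_inf [set ereal_sup [set (phi i (h i x) * `|f x - c|)%:E | x in U i]
            | c in [set: R]].

Definition sharp_fun f : \bar R :=
  \big[maxe/core_seminorm f]_(i < m) end_seminorm i f.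

Definition sharp_norm (q : C_mod_const A R) : \bar R := sharp_fun (repr q).

Let shift_inf (T : Type) (F : R -> T) (b : R) :
  [set F (c - b) | c in [set: R]] = [set F c | c in [set: R]].
Proof.
apply/seteqP; split=> _ [c _ <-]; first by exists (c - b).
by exists (c + b) => //; rewrite addrK.
Qed.

Lemma sharp_fun_shift f g b :
  (forall x, f x = g x + b) -> sharp_fun f = sharp_fun g.
Proof.
move=> fg; have fgc x c : f x - c = g x - (c - b) by rewrite fg opprB addrA.
rewrite /sharp_fun.
have -> : core_seminorm f = core_seminorm g.
  rewrite /core_seminorm -[in RHS](shift_inf _ b).
  by under eq_imagel => c _ do under eq_imagel => x _ do rewrite fgc.
apply: eq_bigr => i _; rewrite /end_seminorm -[in RHS](shift_inf _ b).
by under eq_imagel => c _ do under eq_imagel => x _ do rewrite fgc.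
Qed.

Lemma sharp_norm_class (f : continuousType A R) :
  sharp_norm (class_of f) = sharp_fun f.
Proof.
have /class_ofP[c fc] := class_of_repr (class_of f).
exact: sharp_fun_shift fc.
Qed.

Definition sharp_space : set (C_mod_const A R) :=
  [set q | (sharp_norm q < +oo)%E].

End sharp_norm.

(* The subset [S] of [V], with the operations of [V] and the norm [N], is a
   Banach space: it is the injective linear image of a complete normed module
   whose norm is carried to [N].  This entails that [S] is a linear subspace
   and that [N] is a finite complete norm on it. *)
Definition banach_space_on (R : realType) (V : lmodType R) (S : set V)
    (N : V -> \bar R) : Prop :=
  exists (B : completeNormedModType R) (j : {linear B -> V}),
    [/\ injective j, range j = S & forall b, N (j b) = `|b|%:E].

(* Main.v *)
(* A weighted sup-distance to the constants is computed by Helly's theorem on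
   the line: [inf_c sup w |f - c| <= e] if and only if
   [|f x - f y| <= e / w x + e / w y] for all [x] and [y].  In this form
   the seminorm axioms are immediate and the bound passes to pointwise limits.
   As the weights are at least 1 and every end has a boundary point in the core,
   a class of norm at most [e] varies by at most [4 e] from a base point of the
   core.  The norm is thus definite, and after normalizing representatives at
   the base point a Cauchy filter converges uniformly, hence to a continuous
   function. *)
Require Import Defs.
From HB Require Import structures.
From mathcomp Require Import all_boot all_order all_algebra.
From mathcomp Require Import all_classical all_reals all_analysis.
From mathcomp Require Import lra.

Set Implicit Arguments.
Unset Strict Implicit.
Unset Printing Implicit Defensive.

Import Order.TTheory GRing.Theory Num.Theory.
Import numFieldNormedType.Exports.

Local Open Scope classical_set_scope.
Local Open Scope ring_scope.

(** * The normed space of the vectors of finite extended norm *)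

Record extended_norm (R : realType) (V : lmodType R) (N : V -> \bar R) : Prop := {
  enorm_ge0 : forall v, (0 <= N v)%E ;
  enorm_triangle : forall u v, (N (u + v)%R <= N u + N v)%E ;
  enorm_scale : forall a v, (N (a *: v)%R <= `|a|%:E * N v)%E ;
  enorm_eq0 : forall v, N v = 0%E -> v = 0
}.

(** Filters live on all of [V], so the limit may be built without first proving its norm finite;
    that follows from the triangle inequality. *)
Definition enorm_complete (R : realType) (V : lmodType R) (N : V -> \bar R) :=
  forall F : set_system V, ProperFilter F ->
  (forall e, 0 < e -> exists2 u, (N u < +oo)%E & F [set v | (N (v - u)%R <= e%:E)%E]) ->
  exists v, forall e, 0 < e -> F [set u | (N (u - v)%R <= e%:E)%E].

Section finite_part.
Context (R : realType) (V : lmodType R) (N : V -> \bar R).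
Context (NP : extended_norm N).

Lemma enorm0 : N 0 = 0%E.
Proof.
apply/eqP; rewrite eq_le enorm_ge0// andbT.
(* [N 0] is not yet known to be finite; the convention that zero times infinity is zero covers that
   case. *)
by have := enorm_scale NP 0 0; rewrite scale0r normr0 mul0e.
Qed.

Lemma enormB u v : N (u - v) = N (v - u).
Proof.
have le w z : (N (w - z)%R <= N (z - w)%R)%E.
  have := enorm_scale NP (-1) (z - w).
  by rewrite scaleN1r opprB normrN1 mul1e.
by apply/eqP; rewrite eq_le !le.
Qed.

(* The phantom argument is what lets the closure instance be inferred. *)
Definition finite_enorm & extended_norm N : {pred V} := fun v => (N v < +oo)%E.

Lemma finite_enorm_submod : submod_closed (finite_enorm NP).
Proof.
split=> [|a u v uf vf]; first by rewrite /finite_enorm unfold_in enorm0.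
rewrite unfold_in /finite_enorm in uf vf *.
apply: le_lt_trans (enorm_triangle NP _ _) _; apply: lte_add_pinfty => //.
apply: le_lt_trans (enorm_scale NP _ _) _.
by rewrite -(@fineK _ (N u)) ?ge0_fin_numE ?enorm_ge0// -EFinM ltry.
Qed.

HB.instance Definition _ :=
  GRing.isSubmodClosed.Build R V (finite_enorm NP) finite_enorm_submod.

Record finite_part := FinitePart {
  finite_part_val :> V ; finite_partP : finite_part_val \in finite_enorm NP }.

HB.instance Definition _ := [isSub for finite_part_val].
HB.instance Definition _ := [Choice of finite_part by <:].
HB.instance Definition _ := [SubChoice_isSubLmodule of finite_part by <:].

Definition finite_norm (b : finite_part) : R := fine (N (val b)).

Lemma finite_normE b : N (val b) = (finite_norm b)%:E.
Proof. by rewrite fineK// ge0_fin_numE ?enorm_ge0//; exact: (valP b). Qed.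

Let normD (b c : finite_part) :
  finite_norm (b + c) <= finite_norm b + finite_norm c.
Proof. by rewrite -lee_fin EFinD -!finite_normE raddfD enorm_triangle. Qed.

Let normZ (a : R) (b : finite_part) :
  finite_norm (a *: b) = `|a| * finite_norm b.
Proof.
have le l (d : finite_part) : finite_norm (l *: d) <= `|l| * finite_norm d.
  by rewrite -lee_fin EFinM -!finite_normE linearZ enorm_scale.
apply/eqP; rewrite eq_le le /=; have [->|a0] := eqVneq a 0.
  by rewrite normr0 mul0r -lee_fin -finite_normE enorm_ge0.
(* The reverse inequality is the direct one for [a^-1] at [a *: b]. *)
have := le a^-1 (a *: b); rewrite scalerA mulVf// scale1r normfV.
by rewrite ler_pdivlMl ?normr_gt0.
Qed.

Let norm_eq0 (b : finite_part) : finite_norm b = 0 -> b = 0.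
Proof.
by move=> b0; apply/val_inj/(enorm_eq0 NP); rewrite finite_normE b0.
Qed.

HB.instance Definition _ :=
  Lmodule_isNormed.Build R finite_part normD normZ norm_eq0.

Lemma finite_part_normE (b : finite_part) : `|b| = finite_norm b.
Proof. by []. Qed.

Context (NC : enorm_complete N).

Lemma finite_part_complete (F : set_system finite_part) :
  ProperFilter F -> cauchy F -> cvg F.
Proof.
move=> FF /cauchyP cF.
have [e e0|v vF] := NC (F := val @ F) _.
  have [b Fb] : exists b : finite_part, F (ball b e) := cF e e0.
  exists (val b); first exact: (valP b).
  apply: (@filterS _ F _ (ball b e)) Fb => c /=; rewrite -ball_normE /= => /ltW bc.
  have -> : val c - val b = val (c - b) by rewrite raddfB.
  by rewrite finite_normE lee_fin -finite_part_normE distrC.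
(* Some [b] of finite norm lies within 1 of [v]. *)
have vfin : v \in finite_enorm NP.
  have [b /= bv] := @filter_ex _ F _ _ (vF _ ltr01).
  rewrite unfold_in /finite_enorm -(subrK (val b) v) addrC.
  apply: le_lt_trans (enorm_triangle NP _ _) _; apply: lte_add_pinfty.
    exact: (valP b).
  by rewrite enormB (le_lt_trans bv) ?ltry.
apply/cvg_ex; exists (FinitePart vfin); apply/cvgrPdist_le => e e0.
apply: (@filterS _ F _ (fun b => N (val b - v) <= e%:E)%E) (vF e e0) => b /=.
by rewrite -lee_fin finite_part_normE -finite_normE raddfB /= enormB.
Qed.

End finite_part.

Lemma banach_space_on_enorm (R : realType) (V : lmodType R) (N : V -> \bar R) :
  extended_norm N -> enorm_complete N ->
  banach_space_on [set v | (N v < +oo)%E] N.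
Proof.
move=> NP NC.
pose cpl := Uniform_isComplete.Build (finite_part NP) (finite_part_complete NC).
pose B : completeNormedModType R := HB.pack (finite_part NP) cpl.
exists B, (val : {linear finite_part NP -> V}); split.
- exact: val_inj.
- apply/seteqP; split=> [_ [b _ <-]|v vfin]; first exact: (valP b).
  by exists (FinitePart (NP := NP) vfin).
- exact: finite_normE.
Qed.

(** * Weighted distance to the constants as an oscillation bound *)

Section weighted_oscillation.
Context (R : realType) (A : Type) (S : set A) (w : A -> R).
Hypothesis (S0 : S !=set0) (w0 : forall x, S x -> 0 < w x).

(* Helly's theorem on the line: the intervals of centre [f x] and radius
   [e / w x] have a common point [c] as soon as any two of them meet. *)
Lemma weighted_oscP (f : A -> R) (e : R) :
  (ereal_inf [set ereal_sup [set (w x * `|f x - c|)%:E | x in S]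
             | c in [set: R]] <= e%:E)%E <->
  forall x y, S x -> S y -> `|f x - f y| <= e / w x + e / w y.
Proof.
split=> [infe x y Sx Sy|osc].
  have wxy : 0 < (w x)^-1 + (w y)^-1 by rewrite addr_gt0 ?invr_gt0 ?w0.
  (* The infimum is not known to be attained, so [c] is chosen with slack [d], which is
     arbitrary. *)
  rewrite -mulrDr -ler_pdivrMr//; apply/ler_addgt0Pr => d d0.
  have [_ [c _ <-] /ltW supd] : exists2 z,
      [set ereal_sup [set (w x * `|f x - c|)%:E | x in S] | c in [set: R]] z &
      (z < (e + d)%:E)%E.
    by apply: ereal_inf_lt; rewrite (le_lt_trans infe)// lte_fin ltrDl.
  have near z : S z -> `|f z - c| <= (e + d) / w z.
    move=> Sz; rewrite ler_pdivlMr ?w0// mulrC -lee_fin.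
    by apply: le_trans supd; apply: ereal_sup_ubound; exists z.
  rewrite ler_pdivrMr// mulrDr; apply: le_trans (lerD (near _ Sx) (near _ Sy)).
  by rewrite (distrC (f y)) ler_distD.
(* [L] collects the left ends of the intervals. Each right end bounds it above, so [sup L] lies in
   every interval. *)
pose L := [set f x - e / w x | x in S].
have Lub y : S y -> ubound L (f y + e / w y).
  by move=> Sy _ [x Sx <-]; have := osc _ _ Sx Sy; rewrite ler_norml; lra.
have Lsup : has_sup L.
  have [x Sx] := S0; split; first by exists (f x - e / w x), x.
  by exists (f x + e / w x); exact: Lub.
apply: le_trans (ereal_inf_lbound _) _; first by exists (sup L).
apply: ge_ereal_sup => _ [x Sx <-]; rewrite lee_fin mulrC -ler_pdivlMr ?w0//.
rewrite distrC ler_distl ge_sup ?andbT; [|by case: Lsup|exact: Lub].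
by apply: sup_upper_bound => //; exists x.
Qed.

End weighted_oscillation.

Lemma cvg_dist_le (R : realType) (T : Type) (F : set_system T) (u : T -> R)
    (l c b : R) : ProperFilter F ->
  u q @[q --> F] --> l -> (\forall q \near F, `|u q - c| <= b) -> `|l - c| <= b.
Proof.
move=> FF ul ub.
apply: (closed_cvg (u_ := fun q => `|u q - c|) _ (@closed_le R b) ub `|l - c|).
by apply: cvg_norm; apply: cvgB ul _; exact: cvg_cst.
Qed.

(** * Oscillation on the core and the ends *)

Section sharp_norm_theory.
Context (R : realType) (A : topologicalType) (K0 : set A) (m : nat).
Context (U : 'I_m -> set A) (h : 'I_m -> A -> R) (phi : 'I_m -> R -> R).
Hypothesis noncompactA : ~ compact [set: A].
Hypothesis decA : end_decomposition K0 U h.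
Hypothesis admissible_phi : forall i, admissible (phi i).

Local Notation C := (continuousType A R).
Local Notation N := (sharp_norm K0 U h phi).

(** Treating the core as one more piece, of weight 1, lets one criterion cover all the seminorms. *)
Definition piece (k : option 'I_m) : set A := if k is Some i then U i else K0.

Definition piece_weight (k : option 'I_m) (x : A) : R :=
  if k is Some i then phi i (h i x) else 1.

(** If there is an end, its boundary points lie in the core. If there is none, an empty core would
    make [A] empty, hence compact. *)
Lemma core_nonempty : K0 !=set0.
Proof.
case: (posnP m) => [m0|m_gt0].
  apply/set0P/eqP => K00; apply: noncompactA.
  have := end_cover decA; rewrite K00 setC0 => ->.
  rewrite bigcup0; first exact: compact0.
  by move=> i _; have := leq_ltn_trans (leq0n i) (ltn_ord i); rewrite {1}m0.
by have [x /(end_boundary_core decA) K0x] :=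
  end_boundary_nonempty decA (Ordinal m_gt0); exists x.
Qed.

Lemma piece_nonempty k : piece k !=set0.
Proof.
case: k => [i|]; last exact: core_nonempty.
by have [x Ux _] := exhaustion_unbounded decA i 0; exists x.
Qed.

Lemma piece_weight_ge1 k x : piece k x -> 1 <= piece_weight k x.
Proof.
case: k => [i|//] Ux.
exact/(weight_ge1 (admissible_phi i))/(exhaustion_ge0 decA).
Qed.

Lemma piece_weight_gt0 k x : piece k x -> 0 < piece_weight k x.
Proof. by move=> /piece_weight_ge1; exact: lt_le_trans. Qed.

Definition osc_le (f : A -> R) (e : R) := forall k x y, piece k x -> piece k y ->
  `|f x - f y| <= e / piece_weight k x + e / piece_weight k y.

Lemma sharp_fun_leP f e : (sharp_fun K0 U h phi f <= e%:E)%E <-> osc_le f e.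
Proof.
have pieceP k := weighted_oscP (piece_nonempty k) (@piece_weight_gt0 k) f e.
have coreE : core_seminorm K0 f =
    ereal_inf [set ereal_sup [set (1 * `|f x - c|)%:E | x in K0]
              | c in [set: R]].
  congr ereal_inf; apply: eq_imagel => c _; congr ereal_sup.
  by apply: eq_imagel => x _; rewrite mul1r.
split=> [/bigmax_leP[le0 le1] [i|]|osc]; [|rewrite coreE in le0|].
- by apply/pieceP; exact: le1.
- exact/(pieceP None).
- apply/bigmax_leP; split=> [|i _]; last exact/(pieceP (Some i))/osc.
  rewrite coreE; exact/(pieceP None)/osc.
Qed.

Lemma sharp_norm_leP f e : (N (class_of f) <= e%:E)%E <-> osc_le f e.
Proof. by rewrite sharp_norm_class; exact: sharp_fun_leP. Qed.

(** At [x = y] in the core, where the weight is 1, the bound reads [0 <= 2 * e]. *)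
Lemma osc_le_ge0 f e : osc_le f e -> 0 <= e.
Proof.
have [x K0x] := core_nonempty.
by move=> /(_ None x x K0x K0x); rewrite subrr normr0 /= !divr1; lra.
Qed.

Lemma osc_le_piece f e k x y :
  osc_le f e -> piece k x -> piece k y -> `|f x - f y| <= 2 * e.
Proof.
move=> osc kx ky; apply: le_trans (osc k x y kx ky) _.
have e0 := osc_le_ge0 osc.
have le z : piece k z -> e / piece_weight k z <= e.
  move=> kz; rewrite ler_pdivrMr ?piece_weight_gt0// ler_peMr//.
  exact: piece_weight_ge1.
by rewrite mulr_natl mulr2n lerD ?le.
Qed.

(** By continuity, the bound [2 * e] on an end persists up to its boundary. A boundary point lies in
    the core, which costs another [2 * e] to reach [p]. *)
Lemma osc_le_base (f : C) e p x : osc_le f e -> K0 p -> `|f x - f p| <= 4 * e.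
Proof.
move=> osc K0p; have e0 := osc_le_ge0 osc.
have [K0x|nK0x] := pselect (K0 x).
  by apply: le_trans (osc_le_piece (k := None) osc K0x K0p) _; lra.
have [i _ Uix] : (\bigcup_i U i) x by rewrite -(end_cover decA).
have [z bz] := end_boundary_nonempty decA i.
have K0z := end_boundary_core decA bz.
have xz : `|f z - f x| <= 2 * e.
  have cl : closed ((fun y => `|f y - f x|) @^-1` [set r | r <= 2 * e]).
    apply: preimage_closed; last exact: closed_le.
    move=> y _; apply: cvg_norm; apply: cvgB; [exact: cts_fun|exact: cvg_cst].
  apply: cl; apply: closureS (proj1 bz) => y Uiy.
  exact: (osc_le_piece (k := Some i)).
have zp := osc_le_piece (k := None) osc K0z K0p.
apply: le_trans (ler_distD (f z) _ _) _; rewrite (distrC (f x)); lra.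
Qed.

(** * Norm axioms and completeness on the quotient by constants *)

Lemma class_exists (q : C_mod_const A R) : exists f : C, class_of f = q.
Proof. by exists (repr q); exact: class_of_repr. Qed.

Lemma class_of0 : class_of (0 : C) = 0.
Proof. by rewrite /class_of raddf0. Qed.

Lemma class_ofB (f g : C) : class_of (f - g) = class_of f - class_of g.
Proof. by rewrite /class_of raddfB. Qed.

Lemma sharp_norm_ge0 q : (0 <= N q)%E.
Proof.
have [f <-] := class_exists q; rewrite leNgt; apply/negP => lt0.
have [e e0 le] : exists2 e, e < 0 & (N (class_of f) <= e%:E)%E.
  move: lt0; case: (N _) => [r|//|_]; first by rewrite lte_fin; exists r.
  (* Here the norm would be minus infinity, so any negative real serves. *)
  by exists (-1); rewrite ?leNye// ltrN10.
by move/sharp_norm_leP/osc_le_ge0: le; rewrite leNgt e0.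
Qed.

Lemma sharp_norm_extended : extended_norm N.
Proof.
have finP q : N q = +oo%E \/ exists2 e, N q = e%:E & 0 <= e.
  have := sharp_norm_ge0 q; case: (N q) => [e|_|//]; last by left.
  by rewrite lee_fin => e0; right; exists e.
split=> [|p q|a q|q].
- exact: sharp_norm_ge0.
- have [f fp] := class_exists p; have [g gq] := class_exists q.
  have [->|[d Nd d0]] := finP p.
    by rewrite addye ?leey// gt_eqF// (lt_le_trans _ (sharp_norm_ge0 _)).
  have [->|[e Ne e0]] := finP q; first by rewrite Nd leey.
  rewrite Nd Ne -EFinD -fp -gq -class_ofD; apply/sharp_norm_leP => k x y kx ky.
  have /sharp_norm_leP/(_ k x y kx ky) : (N (class_of f) <= d%:E)%E by rewrite fp Nd.
  have /sharp_norm_leP/(_ k x y kx ky) : (N (class_of g) <= e%:E)%E by rewrite gq Ne.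
  move=> le1 le2; rewrite !cts_addE opprD addrACA.
  by apply: le_trans (ler_normD _ _) _; lra.
- have [f fq] := class_exists q.
  have [->|[e Ne e0]] := finP q.
    (* With [N q] infinite and [a = 0] the right-hand side is 0 by convention, so the zero class is
       bounded directly. *)
    have [->|a0] := eqVneq a 0; last by rewrite gt0_muley ?leey// lte_fin normr_gt0.
    rewrite normr0 mul0e scale0r -class_of0; apply/sharp_norm_leP => k x y _ _.
    by rewrite subrr normr0 !mul0r addr0.
  rewrite Ne -EFinM -fq -class_ofZ; apply/sharp_norm_leP => k x y kx ky.
  have /sharp_norm_leP/(_ k x y kx ky) le : (N (class_of f) <= e%:E)%E by rewrite fq Ne.
  rewrite !cts_scaleE -mulrBr normrM -!mulrA -mulrDr.
  exact: ler_wpM2l.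
- have [f <-] := class_exists q => Nf0; have [p K0p] := core_nonempty.
  have osc : osc_le f 0 by apply/sharp_norm_leP; rewrite Nf0.
  rewrite -class_of0; apply/class_ofP; exists (f p) => x; rewrite add0r; apply/eqP.
  by rewrite -subr_eq0 -normr_le0 -(mulr0 4) (osc_le_base _ osc).
Qed.

Lemma sharp_norm_complete : enorm_complete N.
Proof.
move=> F FF cF; have [p K0p] := core_nonempty.
(* Representatives are fixed only up to a constant; making them vanish at [p] allows pointwise
   limits. *)
pose g (q : C_mod_const A R) x := (repr q : C) x - (repr q : C) p.
have reprB q r : class_of (repr q - repr r : C) = q - r.
  by rewrite class_ofB !class_of_repr.
have gB q r e x : (N (q - r)%R <= e%:E)%E -> `|g q x - g r x| <= 4 * e.
  rewrite -reprB => /sharp_norm_leP osc.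
  have := osc_le_base x osc K0p; rewrite !cts_addE !cts_oppE /g.
  by congr (`|_| <= _); lra.
have g_cvg x : cvg (g q x @[q --> F]).
  apply/cauchy_cvgP/cauchy_exP => e e0.
  (* The factor 4 of [gB] gives [e / 2], strictly below [e] as an open ball requires. *)
  have [r _ Fr] := cF (e / 8) ltac:(lra); exists (g r x).
  apply: (@filterS _ F _ [set q | (N (q - r)%R <= (e / 8)%:E)%E]) Fr => q /gB qr.
  by rewrite -ball_normE /= distrC (le_lt_trans (qr x)); lra.
pose l x := lim (g q x @[q --> F]).
(* The set in [F] does not depend on [x], so the approximation is uniform. *)
have l_near e r : F [set q | (N (q - r)%R <= e%:E)%E] ->
    forall x, `|l x - g r x| <= 4 * e.
  move=> Fr x; apply: cvg_dist_le (g_cvg x) _.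
  by apply: (@filterS _ F _ [set q | (N (q - r)%R <= e%:E)%E]) Fr => q /gB.
have l_cts : continuous l.
  move=> x; apply/cvgrPdist_le => e e0.
  (* Thirds of [e]: [4 * (e / 12)] at each of [x] and [y], and [e / 3] for the continuity of
     [repr r]. *)
  have [r _ Fr] := cF (e / 12) ltac:(lra).
  have l_r := l_near (e / 12) r Fr.
  have /cvgrPdist_le/(_ (e / 3) ltac:(lra)) :
      (repr r : C) y @[y --> x] --> (repr r : C) x.
    exact: cts_fun.
  apply: filterS => y; have := l_r x; have := l_r y.
  rewrite /g !ler_norml => /andP[? ?] /andP[? ?] /andP[? ?]; apply/andP; split; lra.
exists (class_of (mkcts l_cts : C)) => e e0.
have [r _ Fr] := cF (e / 2) ltac:(lra).
(* The oscillation bound for [q - r], at fixed [x] and [y], passes to the limit in [q]. *)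
have l_r : (N (class_of (mkcts l_cts : C) - r)%R <= (e / 2)%:E)%E.
  rewrite -{1}[r]class_of_repr -class_ofB; apply/sharp_norm_leP => k x y kx ky.
  pose u q := g q x - g q y.
  have u_cvg : u q @[q --> F] --> l x - l y by apply: cvgB; exact: g_cvg.
  rewrite !cts_addE !cts_oppE opprD addrACA -opprD.
  apply: cvg_dist_le u_cvg _.
  apply: (@filterS _ F _ [set q | (N (q - r)%R <= (e / 2)%:E)%E]) Fr => q.
  rewrite /= -reprB => /sharp_norm_leP/(_ k x y kx ky).
  by rewrite !cts_addE !cts_oppE /u /g; congr (`|_| <= _); lra.
apply: (@filterS _ F _ [set q | (N (q - r)%R <= (e / 2)%:E)%E]) Fr => q /= qr.
rewrite -(subrKA r) [e in e%:E]splitr EFinD.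
apply: le_trans (enorm_triangle sharp_norm_extended _ _) _.
by apply: leeD => //; rewrite (enormB sharp_norm_extended).
Qed.

End sharp_norm_theory.

Theorem theorem8p8 (R : realType) (A : topologicalType)
    (hausdorffA : hausdorff_space A)
    (loc_compactA : locally_compact [set: A])
    (sigma_compactA : sigma_compact A)
    (noncompactA : ~ compact [set: A])
    (K0 : set A) (m : nat) (U : 'I_m -> set A) (h : 'I_m -> A -> R)
    (decA : end_decomposition K0 U h)
    (phi : 'I_m -> R -> R)
    (admissible_phi : forall i, admissible (phi i)) :
  banach_space_on (sharp_space K0 U h phi) (sharp_norm K0 U h phi).
Proof.
apply: banach_space_on_enorm.
- exact: sharp_norm_extended.
- exact: sharp_norm_complete.
Qed.
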